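(* Let $T_1$ and $T_2$ be two tournaments with $p$ and $q$ vertices respectively. (i) If $p$ and $q$ are even, then $T_1 \rightarrow T_2$ is unimodular if and only if $T_1$ and $T_2$ are both unimodular. (ii) If $p$ and $q$ are odd, then $T_1 \rightarrow T_2$ is unimodular if and only if $T_1^{+}$ and $T_2^{+}$ are both unimodular.
   Context: The skew-adjacency matrix of a tournament with vertex set $\{v_1,\ldots,v_n\}$ is the $n\times n$ zero-diagonal matrix $S=[s_{ij}]$ in which $s_{ij}=1$ and $s_{ji}=-1$ if $v_i$ dominates $v_j$ (i.e. the arc goes from $v_i$ to $v_j$). The determinant $\det(T)$ of a tournament $T$ is the determinant of its skew-adjacency matrix; $T$ is unimodular if $\det(T)=1$. The join $T_1\rightarrow T_2$ of a tournament $T_1$ to a tournament $T_2$ is the tournament obtained from the disjoint union of $T_1$ and $T_2$ by adding an arc from each vertex of $T_1$ to every vertex of $T_2$. For a tournament $T$, $T^{+}$ denotes the join of $T$ to a tournament with one vertex. *)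

(* Defs.v *)
From HB Require Import structures.
From mathcomp Require Import all_boot all_order all_algebra.
Set Implicit Arguments.
Unset Strict Implicit.
Unset Printing Implicit Defensive.
Import Order.TTheory GRing.Theory Num.Theory.
Local Open Scope ring_scope.

(* [arc T i j] means that i dominates j; [(+)] is exclusive or. *)
Record tournament (n : nat) := Tournament {
  arc : rel 'I_n;
  arc_irrefl : irreflexive arc;
  arc_xor : forall i j : 'I_n, i != j -> arc i j (+) arc j i
}.

Definition skew_adj (n : nat) (T : tournament n) : 'M[int]_n :=
  \matrix_(i < n, j < n)
    (if arc T i j then 1 else if arc T j i then -1 else 0).

Definition tdet (n : nat) (T : tournament n) : int := \det (skew_adj T).

Definition unimodular (n : nat) (T : tournament n) : Prop := tdet T = 1.

Section Join.
Variables (p q : nat) (T1 : tournament p) (T2 : tournament q).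

(* The vertices of the disjoint union are 'I_(p + q): [split] sends the first
   p of them to vertices of T1 ([inl]), the last q to vertices of T2 ([inr]). *)
Definition join_arc : rel 'I_(p + q) := fun x y =>
  match split x, split y with
  | inl i, inl j => arc T1 i j
  | inl _, inr _ => true
  | inr _, inl _ => false
  | inr i, inr j => arc T2 i j
  end.

Lemma join_arc_irrefl : irreflexive join_arc.
Proof.
by move=> x; rewrite /join_arc; case: (split x) => i; rewrite arc_irrefl.
Qed.

Lemma join_arc_xor (x y : 'I_(p + q)) :
  x != y -> join_arc x y (+) join_arc y x.
Proof.
rewrite -(inj_eq (can_inj (@splitK p q))) /join_arc.
by case: (split x) => i; case: (split y) => j // ne_ij; apply: arc_xor.
Qed.

Definition join : tournament (p + q) :=
  Tournament join_arc_irrefl join_arc_xor.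

End Join.

Lemma point_arc_irrefl : irreflexive (fun _ _ : 'I_1 => false).
Proof. by []. Qed.

Lemma point_arc_xor (i j : 'I_1) : i != j -> false (+) false.
Proof. by rewrite !ord1. Qed.

Definition point : tournament 1 := Tournament point_arc_irrefl point_arc_xor.

Definition plus (n : nat) (T : tournament n) : tournament (n + 1) :=
  join T point.

(* Main.v *)
(* The skew-adjacency matrix of T1 -> T2 is [S1, u v^T; - v u^T, S2] with u, v
   all-ones vectors, and its off-diagonal blocks have rank one. This yields
     det (T1 -> T2) = det T1 * det T2 + det T1^+ * det T2^+.
   Skew matrices of odd order have determinant 0, so only one product survives
   in each parity case; the determinant of a skew matrix is nonnegative, so a
   product of two of them is 1 only if both are 1. *)
Require Import Defs.
From mathcomp Require Import all_boot all_order all_algebra.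
From mathcomp Require Import realalg.
Set Implicit Arguments.
Unset Strict Implicit.
Unset Printing Implicit Defensive.
Import Order.TTheory GRing.Theory Num.Theory.
Local Open Scope ring_scope.

(** Block LU factorisation: the left factor carries [\det A], the right one the Schur complement of
    [A]. *)
Lemma det_block_schur (R : comUnitRingType) (m n : nat) (A : 'M[R]_m)
    (C : 'M_(m, n)) (D : 'M_(n, m)) (B : 'M_n) :
  A \in unitmx ->
  \det (block_mx A C D B) = \det A * \det (B - D *m invmx A *m C).
Proof.
move=> uA.
have -> : block_mx A C D B =
    block_mx A 0 D 1%:M
    *m block_mx 1%:M (invmx A *m C) 0 (B - D *m invmx A *m C).
  rewrite mulmx_block !mulmx1 !mul1mx !mul0mx !addr0.
  by rewrite (mulKVmx uA) !mulmxA addrCA subrr addr0.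
by rewrite det_mulmx det_lblock det_ublock !det1 mulr1 mul1r.
Qed.

(** With [u] all ones and [A] the skew-adjacency matrix of [T], this is that of [plus T]. *)
Definition bordered (R : pzRingType) (n : nat) (A : 'M[R]_n) (u : 'cV_n) :
  'M_(n + 1) := block_mx A u (- u^T) 0.

Lemma map_bordered (R S : pzRingType) (f : {rmorphism R -> S}) (n : nat)
    (A : 'M[R]_n) (u : 'cV_n) :
  map_mx f (bordered A u) = bordered (map_mx f A) (map_mx f u).
Proof. by rewrite map_block_mx map_mxN -map_trmx map_mx0. Qed.

Definition rank1_join (R : pzRingType) (p q : nat) (A : 'M[R]_p) (B : 'M_q)
  (u : 'cV_p) (v : 'cV_q) : 'M_(p + q) :=
  block_mx A (u *m v^T) (- (v *m u^T)) B.

Lemma map_rank1_join (R S : pzRingType) (f : {rmorphism R -> S}) (p q : nat)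
    (A : 'M[R]_p) (B : 'M_q) (u : 'cV_p) (v : 'cV_q) :
  map_mx f (rank1_join A B u v) =
  rank1_join (map_mx f A) (map_mx f B) (map_mx f u) (map_mx f v).
Proof. by rewrite map_block_mx map_mxN !map_mxM -!map_trmx. Qed.

(* Eliminating the last column of [B, v; - c v^T, 1] gives the left-hand side;
   splitting its last row as c (- v^T, 0) + (0, 1) gives the right-hand side. *)
Lemma det_rank1_update (R : comPzRingType) (n : nat) (B : 'M[R]_n)
    (v : 'cV_n) (c : R) :
  \det (B + c *: (v *m v^T)) = \det B + c * \det (bordered B v).
Proof.
pose M := block_mx B v (- (c *: v^T)) (1%:M : 'M_1).
have -> : \det (B + c *: (v *m v^T)) = \det M.
  have -> : M = block_mx 1%:M v 0 1%:M *m
      block_mx (B + c *: (v *m v^T)) 0 (- (c *: v^T)) 1%:M.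
    rewrite mulmx_block !mulmx1 !mul1mx !mul0mx !add0r.
    by rewrite mulmxN -scalemxAr addrK.
  by rewrite det_mulmx det_ublock det_lblock !det1 mulr1 !mul1r mulr1.
rewrite addrC -[\det B]mulr1 -(det1 R 1) -(det_ublock _ v) -[X in _ + X]mul1r.
apply: (@determinant_multilinear _ _ _ _ _ (rshift n ord0)); last 2 first.
(* Deleting the last row empties the lower block, so only the common upper rows remain. *)
- by rewrite !row'Kd; congr (castmx _ (col_mx _ _)); apply/matrixP=> [[]].
- by rewrite !row'Kd; congr (castmx _ (col_mx _ _)); apply/matrixP=> [[]].
rewrite !rowKd !row_row_mx !scale_row_mx add_row_mx !row_id.
by rewrite scalerN !scaler0 scale1r !addr0 add0r.
Qed.

Lemma det_rank1_join_unit (R : comUnitRingType) (p q : nat) (A : 'M[R]_p)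
    (B : 'M_q) (u : 'cV_p) (v : 'cV_q) :
  A \in unitmx ->
  \det (rank1_join A B u v) =
  \det A * \det B + \det (bordered A u) * \det (bordered B v).
Proof.
move=> uA.
rewrite /rank1_join [bordered A u]/bordered !(det_block_schur _ _ _ uA).
rewrite [\det (0 - _)]det_mx11.
(* The 1 x 1 Schur complement of [A] in [bordered A u] is [w]; in the join it is [B] plus the
   rank-one term w v v^T. *)
set w := u^T *m invmx A *m u.
rewrite !mulNmx -/w sub0r opprK opprK.
have -> : v *m u^T *m invmx A *m (u *m v^T) = w 0 0 *: (v *m v^T).
  transitivity (v *m w *m v^T); first by rewrite /w !mulmxA.
  by rewrite [w in LHS]mx11_scalar mul_mx_scalar -scalemxAl.
by rewrite det_rank1_update mulrDr mulrA.
Qed.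

(* Both sides are polynomial in A, so A may be replaced by the matrix X I + A
   over R[X], which is invertible over the fraction field. *)
Lemma det_rank1_join (R : idomainType) (p q : nat) (A : 'M[R]_p)
    (B : 'M_q) (u : 'cV_p) (v : 'cV_q) :
  \det (rank1_join A B u v) =
  \det A * \det B + \det (bordered A u) * \det (bordered B v).
Proof.
(* The sign makes [P] equal to X I + A; being a characteristic polynomial, its determinant is monic,
   hence nonzero. *)
pose P := char_poly_mx (- A).
pose up (m n : nat) (M : 'M[R]_(m, n)) := map_mx (@polyC R) M.
have eqP : \det (rank1_join P (up _ _ B) (up _ _ u) (up _ _ v)) =
    \det P * \det (up _ _ B)
    + \det (bordered P (up _ _ u)) * \det (bordered (up _ _ B) (up _ _ v)).
  apply/eqP; rewrite -tofrac_eq; apply/eqP.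
  rewrite rmorphD !rmorphM /= -!det_map_mx !map_bordered map_rank1_join.
  apply: det_rank1_join_unit; rewrite unitmxE unitfE det_map_mx tofrac_eq0.
  exact/monic_neq0/char_poly_monic.
have := congr1 (horner_eval 0) eqP.
rewrite rmorphD !rmorphM /= -!det_map_mx !map_bordered map_rank1_join.
have downK m n (M : 'M[R]_(m, n)) : map_mx (horner_eval 0) (up _ _ M) = M.
  by apply/matrixP=> i j; rewrite !mxE /= /horner_eval hornerC.
rewrite !downK; suff -> : map_mx (horner_eval 0) P = A by [].
apply/matrixP=> i j; rewrite !mxE /= /horner_eval !hornerE.
by rewrite hornerMn hornerX mul0rn sub0r opprK.
Qed.

(** Transposition gives det A = (-1)^n det A = - det A, which forces 0 in characteristic 0. *)
Lemma skew_det_odd (R : numDomainType) (n : nat) (A : 'M[R]_n) :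
  A^T = - A -> odd n -> \det A = 0.
Proof.
move=> skA on; have := det_tr A.
by rewrite skA -scaleN1r detZ -signr_odd on mulN1r => /eqP;
  rewrite eqNr => /eqP.
Qed.

(* x A + (1 - x) I is invertible for 0 <= x < 1, so its determinant does not
   change sign between x = 0, where it is 1, and x = 1. *)
Lemma skew_det_ge0_rcf (R : rcfType) (n : nat) (A : 'M[R]_n) :
  A^T = - A -> 0 <= \det A.
Proof.
move=> skA; rewrite leNgt; apply/negP=> detA_lt0.
pose N x := x *: A + (1 - x)%:M.
pose P : 'M_n := 'X *: map_mx polyC A + (1 - 'X)%:M.
have hP x : (\det P).[x] = \det (N x).
  rewrite -[_.[x]]/(horner_eval x _) -det_map_mx; congr (\det _).
  apply/matrixP=> i j; rewrite !mxE /= /horner_eval hornerD hornerMn.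
  by rewrite hornerM hornerX hornerC hornerD hornerN hornerX hornerC.
(* The determinant is negated because [poly_ivt] expects a value <= 0 on the left and >= 0 on the
   right. *)
have [] := @poly_ivt R (- \det P) 0 1 ler01.
  rewrite !hornerE !hP /N !subrr subr0 scale0r scale1r add0r.
  by rewrite raddf0 addr0 det1 oppr_le0 ler01 oppr_ge0 ltW.
move=> x /andP[x0 x1]; rewrite rootN /root hP => detN.
have {}x1 : x < 1.
  rewrite lt_neqAle x1 andbT; apply: contraTneq detN => ->.
  by rewrite /N subrr scale1r raddf0 addr0 lt_eqF.
have [v v0 vN] := det0P detN.
(* This 1 x 1 matrix is skew, hence zero. *)
have vAv : v *m A *m v^T = 0.
  have : (v *m A *m v^T)^T = - (v *m A *m v^T).
    by rewrite !trmx_mul trmxK skA mulNmx mulmxN mulmxA.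
  move=> /matrixP /(_ 0 0) /eqP; rewrite !mxE eq_sym eqNr => /eqP vAv0.
  by rewrite [LHS]mx11_scalar !mxE vAv0 raddf0.
(* Multiplying [vN] by v^T kills the skew part and leaves a multiple of a sum of squares, so [v]
   would vanish. *)
have : (1 - x) *: (v *m v^T) = 0.
  have := congr1 (fun M => M *m v^T) vN.
  by rewrite mulmxDr mulmxDl -scalemxAr -scalemxAl vAv scaler0 add0r
     mul_mx_scalar -scalemxAl mul0mx.
move=> /eqP; rewrite scaler_eq0 subr_eq0 gt_eqF //= => /eqP/matrixP/(_ 0 0).
rewrite !mxE => /eqP; rewrite psumr_eq0; last first.
  by move=> i _; rewrite mxE -expr2 sqr_ge0.
move=> /allP vi0; case/eqP: v0; apply/rowP=> i.
by have := vi0 i (mem_index_enum _); rewrite !mxE mulf_eq0 orbb => /eqP.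
Qed.

(** The intermediate value argument needs a real closed field, hence the passage to [realalg]. *)
Lemma skew_det_ge0 (n : nat) (A : 'M[int]_n) : A^T = - A -> 0 <= \det A.
Proof.
move=> skA; rewrite -(ler0z realalg) -det_map_mx.
by apply: skew_det_ge0_rcf; rewrite map_trmx skA map_mxN.
Qed.

Lemma skew_adjP (n : nat) (T : tournament n) : (skew_adj T)^T = - skew_adj T.
Proof.
apply/matrixP=> i j; rewrite !mxE.
have [->|/(@arc_xor _ T)] := eqVneq i j; first by rewrite arc_irrefl oppr0.
by case: (Defs.arc T i j) (Defs.arc T j i) => [] [] // _; rewrite opprK.
Qed.

Lemma skew_adj_join (p q : nat) (T1 : tournament p) (T2 : tournament q) :
  skew_adj (join T1 T2) =
  rank1_join (skew_adj T1) (skew_adj T2) (const_mx 1) (const_mx 1).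
Proof.
apply/matrixP=> i j; rewrite !mxE /= /join_arc.
case: (split i) => i'; rewrite !mxE; case: (split j) => j'; rewrite !mxE //.
  by rewrite big_ord1 !mxE mulr1.
by rewrite big_ord1 !mxE mulr1.
Qed.

Lemma skew_adj_plus (n : nat) (T : tournament n) :
  skew_adj (plus T) = bordered (skew_adj T) (const_mx 1).
Proof.
rewrite skew_adj_join /rank1_join /bordered; congr block_mx.
- by apply/matrixP=> i j; rewrite !mxE big_ord1 !mxE mulr1.
- by apply/matrixP=> i j; rewrite !mxE big_ord1 !mxE mulr1.
- by apply/matrixP=> i j; rewrite !mxE.
Qed.

Lemma tdet_ge0 (n : nat) (T : tournament n) : 0 <= tdet T.
Proof. exact/skew_det_ge0/skew_adjP. Qed.

Lemma tdet_join (p q : nat) (T1 : tournament p) (T2 : tournament q) :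
  tdet (join T1 T2) = tdet T1 * tdet T2 + tdet (plus T1) * tdet (plus T2).
Proof. by rewrite /tdet skew_adj_join !skew_adj_plus det_rank1_join. Qed.

Lemma tdet_odd (n : nat) (T : tournament n) : odd n -> tdet T = 0.
Proof. exact/skew_det_odd/skew_adjP. Qed.

Lemma mulz_ge0_eq1 (a b : int) :
  0 <= a -> 0 <= b -> a * b = 1 <-> a = 1 /\ b = 1.
Proof.
case: a b => [a|//] [b|//] _ _; split=> [[] /eqP|[-> ->]] //.
by rewrite muln_eq1 => /andP[/eqP-> /eqP->].
Qed.

Theorem theorem1p2 (p q : nat) (T1 : tournament p) (T2 : tournament q) :
  (~~ odd p -> ~~ odd q ->
     (unimodular (join T1 T2) <-> unimodular T1 /\ unimodular T2)) /\
  (odd p -> odd q ->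
     (unimodular (join T1 T2) <->
      unimodular (plus T1) /\ unimodular (plus T2))).
Proof.
rewrite /unimodular tdet_join; split=> hp hq.
  (* [plus T1] has odd order p + 1, so the second product vanishes. *)
  rewrite (tdet_odd (plus T1)) ?oddD ?addbT // mul0r addr0.
  exact: mulz_ge0_eq1 (tdet_ge0 _) (tdet_ge0 _).
rewrite (tdet_odd T1) // mul0r add0r.
exact: mulz_ge0_eq1 (tdet_ge0 _) (tdet_ge0 _).
Qed.
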